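(* Let $G$ be a trusted-repeater network in which Alice and Bob are connected by $n$ pairwise disjoint paths $P_1,\dots,P_n$, each of length at most $\ell$ (write $\ell_i\le\ell$ for the number of edges of $P_i$). Let the QKD keys $q_{i,j}$ ($1\le i\le n$, $1\le j\le\ell_i$) shared across the edges each be $\varepsilon$-private against quantum side information. Let $\Pi_r$ be the relay protocol that uses the scheme $\mathsf{Share}^*=\mathsf{Share}\circ\mathsf{Encode}$, $\mathsf{Recover}^*=\mathsf{Decode}\circ\mathsf{Recover}$, built from a perfectly confidential linear secret-sharing scheme $(\mathsf{Share},\mathsf{Recover})$ and a $\delta$-AMD code $(\mathsf{Encode},\mathsf{Decode})$, and relays the $i$-th share over path $P_i$ by one-time-pad decryption and re-encryption. Then, for all (computationally unbounded) adversaries $\mathcal{A}$, $$\Pr[\text{Forge-Relay}(\Pi_r,\mathcal{A})=1]\le n\,\ell\,\varepsilon+\delta .$$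
   Context: **Missing values.** $\bot$ denotes a missing value; $\bot+x=x+\bot=\bot$ for all $x$ (likewise for subtraction). **Secret sharing.** Fix $n$ and an access structure, which determines which subsets of $\{1,\dots,n\}$ are *qualified*; other subsets are *unqualified*. A secret-sharing scheme is a pair $(\mathsf{Share},\mathsf{Recover})$: the probabilistic function $\mathsf{Share}$ sends a secret $S$ in a secret space to a vector of shares $(S_1,\dots,S_n)\in\mathcal{Y}^n$, where here $\mathcal{Y}$ is a finite additive group; $\mathsf{Recover}$ maps a vector in $(\mathcal{Y}\cup\{\bot\})^n$ to a secret or to $\bot$ (shares may be missing, and recovery may fail or reject, in which case the output is $\bot$). Correctness: for every qualified $B$, replacing by $\bot$ the shares with index outside $B$ and applying $\mathsf{Recover}$ gives $S$. *Perfectly confidential*: for every unqualified $A$, the shares $(S_i)_{i\in A}$ reveal no information about $S$, i.e. their distribution does not depend on $S$. *Linear*: the secret space is an additive group $\mathcal{G}$ and $\mathsf{Recover}(\vec S+\vec S')=\mathsf{Recover}(\vec S)+\mathsf{Recover}(\vec S')$, with componentwise addition; formally, linearity is only with respect to non-missing shares. **AMD code.** A $\delta$-AMD code is a probabilistic map $\mathsf{Encode}:\mathcal{S}\to\mathcal{G}$ from a set to a group and a map $\mathsf{Decode}:\mathcal{G}\to\mathcal{S}\cup\{\bot\}$ with $\mathsf{Decode}(\mathsf{Encode}(s))=s$ with probability $1$ for all $s\in\mathcal{S}$, and $\Pr[\mathsf{Decode}(\mathsf{Encode}(s)+\Delta)\notin\{s,\bot\}]\le\delta$ for all $s\in\mathcal{S}$,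 $\Delta\in\mathcal{G}$. Set $\mathsf{Decode}(\bot)=\bot$. Here $\mathcal{G}$ is the secret space of $(\mathsf{Share},\mathsf{Recover})$. **Network and keys.** The network is static; Alice and Bob are honest. Paths are disjoint if they share no vertex other than Alice and Bob. Key $q_{i,j}\in\mathcal{Y}$ belongs to the $j$-th edge of $P_i$ and is held identically by both endpoints of that edge. A classical-quantum state $\rho_{XE}=\sum_x P_X(x)|x\rangle\langle x|\otimes\rho_E^x$, the joint state of a classical variable $X$ (a key) and the adversary's quantum system $E$, is *$\varepsilon$-private against quantum side information* if $\frac12\|\rho_{XE}-\rho_U\otimes\rho_E\|_1\le\varepsilon$, where $\rho_U=\sum_x\frac1{|\mathcal{X}|}|x\rangle\langle x|$ is the uniform distribution over the set $\mathcal{X}$ of values of $X$ (here $\mathcal{X}=\mathcal{Y}$), $\rho_E=\sum_xP_X(x)\rho_E^x$, and $\|\cdot\|_1$ is the trace norm. The hypothesis is that each individual key $q_{i,j}$ is $\varepsilon$-private in this sense. **Game Forge-Relay$(\Pi_r,\mathcal{A})$**, with $\mathcal{A}=(\mathcal{A}_0,\mathcal{A}_1)$: 1. $\mathcal{A}_0$ outputs $s\in\mathcal{S}$. 2. $\vec S=(S_1,\dots,S_n)\leftarrow\mathsf{Share}^*(s)$. 3. All keys $q_{i,j}$ are sampled by QKD (the adversary holding the side information $E$). 4. $c_{i,1}=S_i+q_{i,1}$ for all $1\le i\le n$. 5. $\mathcal{A}_1$, given $(c_{1,1},\dots,c_{n,1})$ and with adaptive access to the oracles Relay and Corrupt, outputs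 $(c'_{1,\ell_1},\dots,c'_{n,\ell_n})$ with entries in $\mathcal{Y}\cup\{\bot\}$. 6. $S_i'=c'_{i,\ell_i}-q_{i,\ell_i}$ for all $1\le i\le n$. 7. The game outputs $1$ if $\mathsf{Recover}^*(S_1',\dots,S_n')\notin\{s,\bot\}$ and the set $T$ is unqualified, and $0$ otherwise. The game maintains sets $R$ and $T$, initially empty. Oracles, for $1\le i\le n$, $2\le j\le\ell_i$ (node $j$ of path $i$, which lies between edges $j-1$ and $j$): - Relay$(i,j,c')$: if $(i,j)\in R$ return $\bot$; otherwise add $(i,j)$ to $R$ and return $c'-q_{i,j-1}+q_{i,j}$. - Corrupt$(i,j)$: if $(i,j)\in R$ return $\bot$; otherwise add $i$ to $T$ and return $(q_{i,j-1},q_{i,j})$.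
   Formalization: Each key is assumed ε-private against E together with all other keys (with E alone, identical keys break the claim), and Recover is assumed to output ⊥ whenever the non-missing shares form an unqualified set (otherwise dropping all messages could forge). *)

(* Defs.v *)
From HB Require Import structures.
From mathcomp Require Import all_boot all_order all_algebra.
From mathcomp Require Export complex mxtens.

Set Implicit Arguments.
Unset Strict Implicit.
Unset Printing Implicit Defensive.

Import Order.TTheory GRing.Theory Num.Theory.
Local Open Scope ring_scope.
Local Open Scope sesquilinear_scope.

(* [None] is the missing value; it is absorbing. *)

Definition oadd (V : zmodType) (x y : option V) : option V :=
  if x is Some a then if y is Some b then Some (a + b) else None else None.

Definition osub (V : zmodType) (x y : option V) : option V :=
  if x is Some a then if y is Some b then Some (a - b) else None else None.

Record dist (R : rcfType) (T : finType) := Dist {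
  pmf :> T -> R;
  pmf_ge0 : forall t, 0 <= pmf t;
  pmf_sum1 : \sum_t pmf t = 1 }.

Definition Pr (R : rcfType) (T : finType) (p : dist R T) (A : pred T) : R :=
  \sum_(t | A t) p t.

Section DistBind.
Variables (R : rcfType) (T U : finType) (p : dist R T) (f : T -> dist R U).

Definition dbind_pmf (u : U) : R := \sum_t p t * f t u.

Lemma dbind_ge0 u : 0 <= dbind_pmf u.
Proof. by apply: sumr_ge0 => t _; rewrite mulr_ge0 ?pmf_ge0. Qed.

Lemma dbind_sum1 : \sum_u dbind_pmf u = 1.
Proof.
rewrite exchange_big /= -(pmf_sum1 p); apply: eq_bigr => t _.
by rewrite -mulr_sumr pmf_sum1 mulr1.
Qed.

Definition dbind : dist R U := Dist dbind_ge0 dbind_sum1.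
End DistBind.

Section SecretSharing.
Variables (R : rcfType) (n : nat) (Y G : finZmodType).
(* Q is the family of qualified sets. *)
Variables (Q : {set {set 'I_n}}).
Variables (Share : G -> dist R {ffun 'I_n -> Y}).
Variables (Recover : {ffun 'I_n -> option Y} -> option G).

Definition mask (B : {set 'I_n}) (x : {ffun 'I_n -> Y}) :
    {ffun 'I_n -> option Y} :=
  [ffun i => if i \in B then Some (x i) else None].

Definition present (x : {ffun 'I_n -> option Y}) : {set 'I_n} :=
  [set i | x i != None].

(* The second clause is the convention that recovery fails when the available
   shares do not form a qualified set.  It does not follow from the other
   properties: otherwise [Recover] could output a fixed valid codeword when all
   shares are missing, and dropping every message would be a forgery. *)
Definition secret_sharing : Prop :=
  (forall g x, 0 < Share g x ->
     forall B, B \in Q -> Recover (mask B x) = Some g) /\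
  (forall x, present x \notin Q -> Recover x = None).

Definition perfectly_confidential : Prop :=
  forall A, A \notin Q -> forall g g' y,
    Pr (Share g) [pred x | mask A x == y] =
    Pr (Share g') [pred x | mask A x == y].

(* Linearity is with respect to the non-missing shares, so it is required of
   vectors with the same missing entries.  (Adding vectors with different
   missing entries loses shares, and additivity for those would rule out every
   scheme that tolerates a missing share.) *)
Definition linear_recover : Prop :=
  forall x y, present x = present y ->
    Recover [ffun i => oadd (x i) (y i)] = oadd (Recover x) (Recover y).

End SecretSharing.

Definition amd_code (R : rcfType) (S : eqType) (G : finZmodType)
    (Encode : S -> dist R G) (Decode : G -> option S) (delta : R) : Prop :=
  (forall s, Pr (Encode s) [pred g | Decode g == Some s] = 1) /\
  (forall s D, Pr (Encode s)
     [pred g | Decode (g + D) \notin [:: Some s; None]] <= delta).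

Section Quantum.
Variable R : rcfType.
Local Notation C := R[i].

Definition psdmx d (A : 'M[C]_d) : Prop :=
  forall v : 'rV[C]_d, 0 <= (v *m A *m v ^t*) 0 0.

(* Meaningful for positive semidefinite A only. *)
Definition sqrtmx d (A : 'M[C]_d) : 'M[C]_d :=
  invmx (spectralmx A) *m diag_mx (map_mx sqrtC (spectral_diag A))
    *m spectralmx A.

Definition trace_norm d (A : 'M[C]_d) : R := complex.Re (\tr (sqrtmx (A ^t* *m A))).

(* A classical-quantum state \sum_x P(x) |x><x| (x) rho^x is given by its
   blocks: [cq_block x] is the subnormalised operator P(x) rho^x, so that
   P(x) = \tr (cq_block x). *)
Record cqstate (X : finType) (d : nat) := CQState {
  cq_block :> X -> 'M[C]_d;
  cq_psd : forall x, psdmx (cq_block x);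
  cq_trace1 : \sum_x \tr (cq_block x) = 1 }.

Definition ketbra (X : finType) (x : X) : 'M[C]_#|X| :=
  delta_mx (enum_rank x) (enum_rank x).

Definition cq_mx (X : finType) d (w : X -> 'M[C]_d) : 'M[C]_(#|X| * d) :=
  \sum_x ketbra x *t w x.

Definition uniform_mx (X : finType) : 'M[C]_#|X| :=
  \sum_x (#|X|%:R)^-1 *: ketbra x.

Definition private (X : finType) d (w : X -> 'M[C]_d) (eps : R) : Prop :=
  2^-1 * trace_norm (cq_mx w - uniform_mx X *t \sum_x w x) <= eps.

(* From the joint state of a family of classical registers q : {ffun I -> Y} and
   a quantum system E, the classical-quantum state of the single register q e,
   the quantum side of which is E together with all the other registers.  The
   other keys count as side information because corruption reveals them; with E
   alone, even fully identical keys could each be private.  For runs that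
   produce independent states rho_(q_e E_e) with E the tensor product of the
   E_e, privacy of this state is privacy of rho_(q_e E_e). *)
Definition single_key (I : finType) (Y : finType) d
    (rho : {ffun I -> Y} -> 'M[C]_d) (e : I) (y : Y) :
    'M[C]_(#|{ffun {e' : I | e' != e} -> Y}| * d) :=
  \sum_(q : {ffun I -> Y} | q e == y)
    ketbra [ffun e' : {e' : I | e' != e} => q (val e')] *t rho q.

End Quantum.

Section Network.
Variables (V : finType) (adj : rel V) (a b : V).

(* A path from a to b is given by its interior vertices. *)
Definition network_path (p : seq V) : bool :=
  path adj a (rcons p b) && uniq (a :: rcons p b).

Definition path_length (p : seq V) : nat := (size p).+1.

Definition pairwise_disjoint n (P : 'I_n -> seq V) : Prop :=
  forall i j v, i != j -> v \in P i -> v \notin P j.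

End Network.

Section Game.
(* Path i has [m i] interior nodes, hence [(m i).+1] edges.  Indices start at 0:
   interior node k of path i is between its edges k and k.+1. *)
Variables (R : rcfType) (n : nat) (m : 'I_n -> nat) (Y : finZmodType).
Local Notation C := R[i].

Definition edge : finType := {i : 'I_n & 'I_(m i).+1}.
Definition node : finType := {i : 'I_n & 'I_(m i)}.
Definition keys : finType := {ffun edge -> Y}.

Definition mkedge (i : 'I_n) (j : 'I_(m i).+1) : edge :=
  Tagged (fun i => 'I_(m i).+1) j.

Definition first_edge (i : 'I_n) : edge := mkedge (@ord0 (m i)).
Definition last_edge (i : 'I_n) : edge := mkedge (@ord_max (m i)).
Definition edge_before (v : node) : edge :=
  mkedge (widen_ord (leqnSn _) (tagged v)).
Definition edge_after (v : node) : edge := mkedge (lift ord0 (tagged v)).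

(* [strategy d] is the type of interactive quantum strategies of an adversary
   that holds a d-dimensional quantum system.  [Instrument] applies a quantum
   instrument with one Kraus operator per classical outcome; changing the
   dimension covers adjoining ancillas and discarding subsystems, and ignoring
   part of the outcome covers the instruments with several Kraus operators per
   outcome. *)
Inductive strategy : nat -> Type :=
| Output d of {ffun 'I_n -> option Y} : strategy d
| Relay d (v : node) (c : option Y) (next : option Y -> strategy d) : strategy d
| Corrupt d (v : node) (next : option (Y * Y) -> strategy d) : strategy d
| Instrument d d' r (K : 'I_r -> 'M[C]_(d', d))
    (K_complete : \sum_x (K x) ^t* *m K x = 1%:M)
    (next : 'I_r -> strategy d') : strategy d.

(* [coins] is the finite internal randomness (and memory) that the two stages
   of the adversary share. *)
Record adversary (S : Type) (d : nat) := Adversary {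
  coins : finType;
  coins_dist : dist R coins;
  adv_secret : coins -> S;
  adv_relay : coins -> {ffun 'I_n -> Y} -> strategy d }.

(* The probability that the strategy, run with relayed nodes [Rs], corrupted
   paths [T] and subnormalised quantum state [rho], ends with an output
   accepted by [win]. *)
Fixpoint run (q : keys) (win : {ffun 'I_n -> option Y} -> {set 'I_n} -> bool)
    d (st : strategy d) {struct st} :
    {set node} -> {set 'I_n} -> 'M[C]_d -> R :=
  match st in strategy d return {set node} -> {set 'I_n} -> 'M[C]_d -> R with
  | Output _ c => fun _ T rho => if win c T then complex.Re (\tr rho) else 0
  | Relay _ v c next => fun Rs T rho =>
      if v \in Rs then run q win (next None) Rs T rho
      else run q win
             (next (oadd (osub c (Some (q (edge_before v))))
                         (Some (q (edge_after v)))))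
             (v |: Rs) T rho
  | Corrupt _ v next => fun Rs T rho =>
      if v \in Rs then run q win (next None) Rs T rho
      else run q win (next (Some (q (edge_before v), q (edge_after v))))
             Rs (tag v |: T) rho
  | Instrument _ _ _ K _ next => fun Rs T rho =>
      \sum_x run q win (next x) Rs T (K x *m rho *m (K x) ^t*)
  end.

Variables (S : eqType) (Q : {set {set 'I_n}}).
Variables (ShareS : S -> dist R {ffun 'I_n -> Y}).
Variables (RecoverS : {ffun 'I_n -> option Y} -> option S).

Definition forged (q : keys) (s : S) (c : {ffun 'I_n -> option Y})
    (T : {set 'I_n}) : bool :=
  (RecoverS [ffun i => osub (c i) (Some (q (last_edge i)))]
     \notin [:: Some s; None])
  && (T \notin Q).

Definition forge_relay d (rho : cqstate R keys d) (A : adversary S d) : R :=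
  \sum_(w : coins A) coins_dist A w *
    \sum_(sh : {ffun 'I_n -> Y}) ShareS (adv_secret w) sh *
      \sum_(q : keys)
        run q (forged q (adv_secret w))
          (adv_relay w [ffun i => sh i + q (first_edge i)]) set0 set0 (rho q).

End Game.

(* Main.v *)
(* A key that is eps-private can be replaced by a uniform key independent of
   everything else at the cost eps in the probability of any event: the two
   states differ by a traceless Hermitian operator, on which a test takes at
   most half the trace norm.  Replacing all keys costs at most n * l * eps.

   With uniform independent keys q, write q = k - x, where x is the share sent
   over the path of the key; then k is uniform and independent of the shares.
   In terms of k, the ciphertexts, the answers of Relay and the offsets S'_i - S_i
   of the received shares do not involve the shares; only the answers of Corrupt
   do, through the shares of corrupted paths.  Hence the probability of ending
   with output c and corrupted set T depends on the shares in T only, and by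
   confidentiality not on the codeword g when T is unqualified.  By linearity
   the recovered codeword is g + D with D a function of k and c, so the AMD code
   bounds the probability of forgery by delta. *)

Require Import Defs.
From mathcomp Require Import all_boot all_order all_algebra ring lra.

Set Implicit Arguments.
Unset Strict Implicit.
Unset Printing Implicit Defensive.

Import Order.TTheory GRing.Theory Num.Theory.
Local Open Scope ring_scope.
Local Open Scope sesquilinear_scope.

(** * Positive operators, trace norm and tests on quantum states *)

Section Matrices.
Variable R : rcfType.
Local Notation C := R[i].
Local Notation Re := complex.Re.

Lemma adjmxM m n p (A : 'M[C]_(m, n)) (B : 'M[C]_(n, p)) :
  (A *m B) ^t* = B ^t* *m A ^t*.
Proof. by rewrite trmx_mul map_mxM. Qed.

Lemma adjmxD m n (A B : 'M[C]_(m, n)) : (A + B) ^t* = A ^t* + B ^t*.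
Proof. by apply/matrixP => i j; rewrite !mxE rmorphD. Qed.

Lemma adjmxZ m n (a : C) (A : 'M[C]_(m, n)) : (a *: A) ^t* = a^* *: A ^t*.
Proof. by apply/matrixP => i j; rewrite !mxE rmorphM. Qed.

Lemma adjmx_sum m n (I : Type) (r : seq I) (P : pred I) (B : I -> 'M[C]_(m, n)) :
  (\sum_(i <- r | P i) B i) ^t* = \sum_(i <- r | P i) (B i) ^t*.
Proof.
by apply/matrixP => i j; rewrite !mxE !summxE rmorph_sum /=;
   apply: eq_bigr => k _; rewrite !mxE.
Qed.

Lemma adjmx_tens m n p q (A : 'M[C]_(m, n)) (B : 'M[C]_(p, q)) :
  (A *t B) ^t* = A ^t* *t B ^t*.
Proof. by apply/matrixP => i j; rewrite !mxE rmorphM. Qed.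

Lemma tens_trace m n (A : 'M[C]_m) (B : 'M[C]_n) :
  \tr (A *t B) = \tr A * \tr B.
Proof. by rewrite /mxtrace mulr_sum; apply: eq_bigr => i _; rewrite mxE. Qed.

Lemma ketbra_herm (X : finType) (x : X) : (ketbra R x) ^t* = ketbra R x.
Proof. by apply/matrixP => i j; rewrite !mxE rmorph_nat andbC. Qed.

Lemma RemxtrD n (A B : 'M[C]_n) : Re (\tr (A + B)) = Re (\tr A) + Re (\tr B).
Proof. by rewrite linearD raddfD. Qed.

Lemma RemxtrZ n (a : R) (A : 'M[C]_n) :
  Re (\tr (a%:C%C *: A)) = a * Re (\tr A).
Proof. by rewrite mxtraceZ; case: (\tr A) => x y /=; rewrite mul0r subr0. Qed.

Lemma psdmx_congr m n (L : 'M[C]_(m, n)) (A : 'M[C]_n) :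
  psdmx A -> psdmx (L *m A *m L ^t*).
Proof. by move=> psdA v; have := psdA (v *m L); rewrite adjmxM !mulmxA. Qed.

Lemma psdmxD n (A B : 'M[C]_n) : psdmx A -> psdmx B -> psdmx (A + B).
Proof.
by move=> psdA psdB v; rewrite mulmxDr mulmxDl mxE addr_ge0 ?psdA ?psdB.
Qed.

Lemma psdmx0 n : psdmx (0 : 'M[C]_n).
Proof. by move=> v; rewrite mulmx0 mul0mx mxE. Qed.

Lemma psdmx_sum n (I : Type) (r : seq I) (B : I -> 'M[C]_n) :
  (forall i, psdmx (B i)) -> psdmx (\sum_(i <- r) B i).
Proof.
move=> psdB; elim: r => [|i r IHr]; first by rewrite big_nil; apply: psdmx0.
by rewrite big_cons; apply: psdmxD.
Qed.

Lemma form_delta n (A : 'M[C]_n) i j :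
  ((delta_mx 0 i : 'rV[C]_n) *m A *m (delta_mx 0 j : 'rV[C]_n) ^t*) 0 0 = A i j.
Proof.
rewrite -rowE mxE (bigD1 j) //= big1 => [|k /negPf kj].
  by rewrite !mxE !eqxx rmorph1 mulr1 addr0.
by rewrite !mxE kj andbF rmorph0 mulr0.
Qed.

Lemma psdmx_diag_ge0 n (A : 'M[C]_n) i : psdmx A -> 0 <= A i i.
Proof. by move=> /(_ (delta_mx 0 i)); rewrite form_delta. Qed.

Lemma psdmx_trace_ge0 n (A : 'M[C]_n) : psdmx A -> 0 <= Re (\tr A).
Proof.
move=> psdA; have : 0 <= \tr A by apply: sumr_ge0 => i _; apply: psdmx_diag_ge0.
by rewrite lecE => /andP[].
Qed.

Lemma psdmx_dyad n (u : 'rV[C]_n) : psdmx (u ^t* *m u).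
Proof.
move=> v; rewrite mulmxA -mulmxA -{2}[u]trmxCK -adjmxM.
by rewrite mxE big_ord1 !mxE mul_conjC_ge0.
Qed.

(* Polarisation: a form that is real on all vectors is Hermitian. *)
Lemma psdmx_hermitian n (A : 'M[C]_n) : psdmx A -> A ^t* = A.
Proof.
move=> psdA; have [B BE] : exists B, B = A - A ^t* by exists (A - A ^t*).
have B0 (v : 'rV[C]_n) : (v *m B *m v ^t*) 0 0 = 0.
  move: (ger0_real (psdA v)) => /CrealP; rewrite BE mulmxBr mulmxBl.
  have EB (X Y : 'M[C]_1) : (X - Y) 0 0 = X 0 0 - Y 0 0 by rewrite !mxE.
  rewrite EB.
  have -> : ((v *m A *m v ^t*) 0 0)^* = ((v *m A *m v ^t*) ^t*) 0 0.
    by rewrite !mxE.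
  by rewrite !adjmxM trmxCK !mulmxA => ->; rewrite subrr.
have Bij i j c : c^* * B i j + c * B j i = 0.
  have := B0 (delta_mx 0 i + c *: delta_mx 0 j).
  have ED (X Y : 'M[C]_1) : (X + Y) 0 0 = X 0 0 + Y 0 0 by rewrite !mxE.
  have EZ a (X : 'M[C]_1) : (a *: X) 0 0 = a * X 0 0 by rewrite !mxE.
  have Bkk k : B k k = 0 by rewrite -(form_delta B) B0.
  rewrite adjmxD adjmxZ !mulmxDr !mulmxDl -!scalemxAr -!scalemxAl.
  by rewrite !ED !EZ !form_delta !Bkk !mulr0 addr0 add0r addrC.
apply/matrixP => i j; apply/esym/eqP; rewrite -subr_eq0.
have -> : A i j - (A ^t*) i j = B i j by rewrite BE !mxE.
(* With c = 1 and c = i, i times the first equation minus the second leaves 2i B_ij = 0. *)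
have h1 := Bij i j 1; have h2 := Bij i j 'i.
rewrite rmorph1 !mul1r in h1; rewrite conjCi mulNr in h2.
have : 'i * B i j *+ 2 = 0 :> C.
  rewrite -[RHS](mulr0 'i) -h1 mulrDr -[RHS]subr0 -h2; ring.
by move/eqP; rewrite mulrn_eq0 /= mulf_eq0 (negPf (neq0Ci _)).
Qed.

Lemma spectralE n (A : 'M[C]_n) : A \is normalmx ->
  A = invmx (spectralmx A) *m diag_mx (spectral_diag A) *m spectralmx A.
Proof. by move/orthomx_spectralP. Qed.

(* The spectral basis chosen for the square of H need not diagonalise H; only
   the multiset of eigenvalues is determined. *)
Lemma spectral_diag_perm n (A P : 'M[C]_n) (e : 'rV[C]_n) :
  A \is normalmx -> P \in unitmx -> A = invmx P *m diag_mx e *m P ->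
  perm_eq [seq spectral_diag A 0 i | i <- enum 'I_n]
          [seq e 0 i | i <- enum 'I_n].
Proof.
(* Both lists are the roots of the characteristic polynomial of [A], which determines them up to
   order. *)
move=> nA uP AE; apply: prod_XsubC_eq.
have charE (T : 'M[C]_n) (v : 'rV[C]_n) : T \in unitmx ->
    A = invmx T *m diag_mx v *m T ->
    char_poly A = \prod_(x <- [seq v 0 i | i <- enum 'I_n]) ('X - x%:P).
  move=> uT ->; rewrite big_map big_enum /=.
  transitivity (char_poly (diag_mx v)); last first.
    rewrite char_poly_trig ?diag_mx_is_trig //.
    by apply: eq_bigr => i _; rewrite mxE eqxx.
  have TT : map_mx polyC (invmx T) *m map_mx polyC T = 1%:M.
    by rewrite -map_mxM mulVmx // map_mx1.
  rewrite /char_poly /char_poly_mx !map_mxM.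
  have {1}-> : 'X%:M = map_mx polyC (invmx T) *m 'X%:M *m map_mx polyC T
              :> 'M[{poly C}]_n.
    by rewrite scalar_mxC -mulmxA TT mulmx1.
  by rewrite -mulmxBl -mulmxBr !det_mulmx mulrAC -det_mulmx TT det1 mul1r.
by rewrite -(charE _ _ (spectral_unit A) (spectralE nA)) (charE P e).
Qed.

(** The eigenvalues of [H *m H] are the squares of those of [H], so their square roots are the
    absolute values. *)
Lemma trace_norm_hermitian n (H : 'M[C]_n) : H ^t* = H ->
  trace_norm H = \sum_i `|Re (spectral_diag H 0 i)|.
Proof.
move=> hH; have nH : H \is normalmx by apply/normalmxP; rewrite hH.
have hermH : H \is hermsymmx.
  by apply/is_hermitianmxP; rewrite expr0 scale1r hH.
have /mxOverP realD := hermitian_spectral_diag_real hermH.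
have HE := spectralE nH.
set P := spectralmx H in HE; set D := spectral_diag H in HE realD *.
have uP : P \in unitmx by apply: spectral_unit.
have nHH : H *m H \is normalmx by apply/normalmxP; rewrite adjmxM hH.
have HHE : H *m H = invmx P *m diag_mx (\row_j (D 0 j * D 0 j)) *m P.
  by rewrite {1 2}HE -mulmx_diag !mulmxA mulmxK.
rewrite /trace_norm hH /sqrtmx mxtrace_mulC mulmxA mulmxV ?spectral_unit //.
rewrite mul1mx mxtrace_diag.
under eq_bigr do rewrite mxE.
have -> : \sum_i sqrtC (spectral_diag (H *m H) 0 i) =
          \sum_(x <- [seq spectral_diag (H *m H) 0 i | i <- enum 'I_n]) sqrtC x.
  by rewrite big_map big_enum.
rewrite (perm_big _ (spectral_diag_perm nHH uP HHE)) big_map big_enum /=.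
rewrite raddf_sum /=; apply: eq_bigr => i _; rewrite mxE.
have Dr : D 0 i \is Num.real by apply: realD.
rewrite -{2}(conj_Creal Dr) -normC_def.
by case/complex_realP: Dr => k ->; rewrite normc_def /= expr0n addr0 sqrtr_sqr.
Qed.

(* The functionals [A |-> \tr (M *m A)] with [0 <= M <= 1], by their values
   on states. *)
Definition effect n (f : 'M[C]_n -> R) : Prop :=
  [/\ forall A B, f (A + B) = f A + f B,
      forall (a : R) A, f (a%:C%C *: A) = a * f A &
      forall A, psdmx A -> 0 <= f A <= Re (\tr A)].

Lemma effect0 n (f : 'M[C]_n -> R) : effect f -> f 0 = 0.
Proof. by case=> _ fZ _; rewrite -(scale0r (0 : 'M_n)) (fZ 0) mul0r. Qed.

Lemma effectB n (f : 'M[C]_n -> R) A B : effect f -> f (A - B) = f A - f B.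
Proof.
case=> fD fZ _; rewrite fD -scaleN1r.
by have -> : -1 = (-1 : R)%:C%C; [rewrite rmorphN rmorph1 | rewrite fZ mulN1r].
Qed.

Lemma effect_sum n (f : 'M[C]_n -> R) I (r : seq I) (P : pred I) B :
  effect f -> f (\sum_(i <- r | P i) B i) = \sum_(i <- r | P i) f (B i).
Proof.
by move=> ef; apply: big_morph => [A A'|]; [case: ef | exact: effect0].
Qed.

(* Only the positive part of H contributes to f, and as H is traceless its
   trace is half the trace norm. *)
Lemma effect_le_trace_norm n (f : 'M[C]_n -> R) (H : 'M[C]_n) :
  effect f -> H ^t* = H -> \tr H = 0 -> f H <= 2^-1 * trace_norm H.
Proof.
move=> ef hH trH; have nH : H \is normalmx by apply/normalmxP; rewrite hH.
have hermH : H \is hermsymmx.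
  by apply/is_hermitianmxP; rewrite expr0 scale1r hH.
have /mxOverP realD := hermitian_spectral_diag_real hermH.
have HE := spectralE nH.
have Pun := spectral_unitarymx H.
rewrite trace_norm_hermitian //.
set P := spectralmx H in HE Pun; set D := spectral_diag H in HE realD *.
pose E i := (row i P) ^t* *m row i P.
have HS : H = \sum_i (Re (D 0 i))%:C%C *: E i.
  rewrite {1}HE invmx_unitary //; apply/matrixP => a b.
  rewrite mul_mx_diag !mxE summxE; apply: eq_bigr => i _.
  by rewrite RRe_real ?realD // !mxE big_ord1 !mxE mulrCA mulrA.
have trE i : \tr (E i) = 1.
  rewrite mxtrace_mulC /mxtrace big_ord1.
  have /matrixP/(_ i i) := unitarymxP Pun; rewrite !mxE eqxx /= mulr1n => <-.
  by apply: eq_bigr => k _; rewrite !mxE.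
have trS : \sum_i Re (D 0 i) = 0.
  transitivity (Re (\tr H)); last by rewrite trH.
  rewrite HS (raddf_sum (@mxtrace _ n)) raddf_sum /=.
  by apply: eq_bigr => i _; rewrite RemxtrZ trE mulr1.
rewrite {1}HS effect_sum //.
(* The eigenvalues sum to zero, so half the trace norm is the sum of the positive parts (|s| + s)/2.
   Each is at least s * f (E i), as 0 <= f (E i) <= 1. *)
have -> : 2^-1 * \sum_i `|Re (D 0 i)| =
          \sum_i 2^-1 * (`|Re (D 0 i)| + Re (D 0 i)).
  by rewrite -mulr_sumr big_split /= trS addr0.
apply: ler_sum => i _; case: (ef) => _ -> /(_ _ (psdmx_dyad (row i P))).
rewrite -/(E i) trE /= => /andP[f0 f1].
by case: ger0P => s; nra.
Qed.

End Matrices.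

(** * Replacing private keys by uniform ones *)

Section Hybrid.
Variables (R : rcfType) (I : finType) (Y : finZmodType) (d : nat).
Local Notation C := R[i].
Local Notation Re := complex.Re.
Local Notation K := {ffun I -> Y}.
Variables (rho : K -> 'M[C]_d) (eps : R).
Hypothesis rho_psd : forall q, psdmx (rho q).

Definition single (e : I) (z : Y) : K := [ffun i => if i == e then z else 0].

Definition other_keys (e : I) (q : K) : {ffun {e' : I | e' != e} -> Y} :=
  [ffun e' => q (val e')].

Lemma other_keys_eq e (q q' : K) :
  (other_keys e q' == other_keys e q) = (q' == q + single e (q' e - q e)).
Proof.
apply/eqP/eqP => [/ffunP eq_o | ->]; apply/ffunP => i.
  rewrite !ffunE; case: (eqVneq i e) => [-> | ie]; first by rewrite addrC subrK.
  by have := eq_o (Sub i ie); rewrite !ffunE /= addr0.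
by rewrite !ffunE (negPf (valP i)) addr0.
Qed.

Lemma sum_other_keys (V : nmodType) e (q : K) (F : K -> V) :
  \sum_(q' | other_keys e q' == other_keys e q) F q' =
  \sum_z F (q + single e z).
Proof.
rewrite (reindex_onto (fun z => q + single e z) (fun q' => q' e - q e)) /=.
  apply: eq_bigl => z; rewrite other_keys_eq !ffunE eqxx.
  by rewrite [q e + z]addrC addrK !eqxx.
by move=> q'; rewrite other_keys_eq => /eqP <-.
Qed.

Section Block.
Variable e : I.
Local Notation dE := (#|{ffun {e' : I | e' != e} -> Y}| * d)%N.

(** Position of the basis vector |q>|a> in the tensor order of [single_key]: key [e], the other
    keys, the quantum system. *)
Definition block_index (q : K) (a : 'I_d) : 'I_(#|Y| * dE) :=
  mxtens_index (enum_rank (q e),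
                mxtens_index (enum_rank (other_keys e q), a)).

Lemma block_index_inj q q' a a' :
  block_index q a = block_index q' a' -> (q, a) = (q', a').
Proof.
move=> eq_i; have eq_p := can_inj (@mxtens_indexK _ _) eq_i.
have /enum_rank_inj qe := congr1 fst eq_p.
have eq_o := can_inj (@mxtens_indexK _ _) (congr1 snd eq_p).
have /enum_rank_inj/eqP qo := congr1 fst eq_o; have /= -> := congr1 snd eq_o.
move: qo; rewrite other_keys_eq qe subrr => /eqP ->; congr (_, _).
by apply/ffunP => i; rewrite !ffunE if_same addr0.
Qed.

Definition block (q : K) (Z : 'M[C]_(#|Y| * dE)) : 'M[C]_d :=
  mxsub (block_index q) (block_index q) Z.

Lemma block_psd q Z : psdmx Z -> psdmx (block q Z).
Proof.
move=> psdZ; pose L := rowsub (block_index q) (1%:M : 'M[C]_(#|Y| * dE)).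
suff -> : block q Z = L *m Z *m L ^t* by apply: psdmx_congr.
have -> : L ^t* = colsub (block_index q) (1%:M : 'M[C]_(#|Y| * dE)).
  by apply/matrixP => i j; rewrite !mxE rmorph_nat eq_sym.
rewrite -rowsubE mulmx_colsub mulmx1.
by apply/matrixP => i j; rewrite !mxE.
Qed.

(** The blocks occupy disjoint diagonal positions, so their traces add up to at most the whole
    trace. Thus reading out all keys and applying the test for their values is a single test. *)
Lemma block_effect (f : K -> 'M[C]_d -> R) : (forall q, effect (f q)) ->
  effect (fun Z => \sum_q f q (block q Z)).
Proof.
move=> ef; split=> [A B | a A | A psdA].
- rewrite -big_split /=; apply: eq_bigr => q _; case: (ef q) => <- _ _.
  by congr (f q _); apply/matrixP => i j; rewrite !mxE.
- rewrite mulr_sumr; apply: eq_bigr => q _; case: (ef q) => _ <- _.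
  by congr (f q _); apply/matrixP => i j; rewrite !mxE.
have fb q : 0 <= f q (block q A) <= Re (\tr (block q A)).
  by case: (ef q) => _ _; apply; apply: block_psd.
rewrite sumr_ge0 => [/= | q _]; last by case/andP: (fb q).
apply: (@le_trans _ _ (\sum_q Re (\tr (block q A)))).
  by apply: ler_sum => q _; case/andP: (fb q).
have A0 k : 0 <= Re (A k k).
  by have := psdmx_diag_ge0 k psdA; rewrite lecE => /andP[].
pose h (x : K * 'I_d) := block_index x.1 x.2.
rewrite [leRHS]raddf_sum /=.
rewrite [leRHS](bigID (mem (h @: setT))) /= ler_wpDr ?sumr_ge0 //.
rewrite big_imset /=; last by case=> q a [q' a'] _ _; apply: block_index_inj.
rewrite [leRHS](eq_bigl xpredT) => [|x]; last by rewrite in_setT.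
have -> : \sum_x Re (A (h x) (h x)) = \sum_q \sum_a Re (A (h (q, a)) (h (q, a))).
  by rewrite pair_bigA /=; apply: eq_bigr => -[].
apply: ler_sum => q _; rewrite raddf_sum /=.
by apply: ler_sum => a _; rewrite mxE.
Qed.

Definition key_deviation : 'M[C]_(#|Y| * dE) :=
  cq_mx (single_key rho e) - uniform_mx R Y *t \sum_x single_key rho e x.

(** A uniform register next to the marginal of the rest has, at [q], the mean of [rho] over all
    shifts of [q] at [e]. *)
Lemma block_deviation q :
  block q key_deviation =
  rho q - ((#|Y|%:R)^-1 : R)%:C%C *: \sum_z rho (q + single e z).
Proof.
have ketE (X : finType) (x y : X) :
    ketbra R x (enum_rank y) (enum_rank y) = (x == y)%:R.
  by rewrite mxE (inj_eq enum_rank_inj) andbb eq_sym.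
(* A singleton [P] gives one value of key [e], the full [P] the marginal of the rest. *)
have skE y (P : pred Y) a b :
    (\sum_(x | P x) single_key rho e x)
      (mxtens_index (enum_rank (other_keys e y), a))
      (mxtens_index (enum_rank (other_keys e y), b)) =
    \sum_(q' | other_keys e q' == other_keys e y) (P (q' e))%:R * rho q' a b.
  rewrite summxE [RHS]big_mkcond [RHS](partition_big (fun q : K => q e) predT) //=.
  rewrite big_mkcond; apply: eq_bigr => x _; rewrite -big_mkcondr /=.
  rewrite summxE; case: ifP => Px; last first.
    by rewrite big1 // => q' /andP[/eqP -> _]; rewrite Px mul0r.
  rewrite big_mkcondr; apply: eq_bigr => q' /eqP ->.
  by rewrite tensmxE ketE Px mul1r; case: eqP; rewrite ?mul0r ?mul1r.
have BE (A B : 'M[C]_(#|Y| * dE)) i j : (A - B) i j = A i j - B i j.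
  by rewrite !mxE.
apply/matrixP => a b; rewrite /block mxE BE [RHS]mxE; congr (_ + _).
  rewrite /cq_mx summxE (bigD1 (q e)) //= tensmxE ketE eqxx mul1r.
  rewrite big1 => [|x /negPf xq]; last by rewrite tensmxE ketE xq mul0r.
  rewrite addr0 -[single_key _ _ _](big_pred1_eq +%R (q e)) skE sum_other_keys.
  rewrite (bigD1 0) //= !ffunE eqxx addr0 eqxx mul1r big1 => [|z /negPf z0].
    rewrite addr0; congr (rho _ a b).
    by apply/ffunP => i; rewrite !ffunE if_same addr0.
  by rewrite !ffunE !eqxx -subr_eq0 [q e + z]addrC addrK z0 mul0r.
rewrite !mxE; congr (- _).
rewrite !mxtens_indexK /= skE sum_other_keys fmorphV rmorph_nat.
congr (_ * _); last by rewrite summxE; apply: eq_bigr => z _; rewrite mul1r.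
rewrite /uniform_mx summxE (bigD1 (q e)) //= mxE ketE eqxx mulr1.
by rewrite big1 ?addr0 // => x /negPf xq; rewrite mxE ketE xq mulr0.
Qed.

Lemma key_deviation_herm : key_deviation ^t* = key_deviation.
Proof.
have hsk y : (single_key rho e y) ^t* = single_key rho e y.
  rewrite adjmx_sum; apply: eq_bigr => q _.
  by rewrite adjmx_tens ketbra_herm psdmx_hermitian.
rewrite /key_deviation -scaleN1r adjmxD adjmxZ rmorphN1 adjmx_tens !adjmx_sum.
congr (_ + _ *: (_ *t _)); apply: eq_bigr => y _ //.
  by rewrite adjmx_tens ketbra_herm hsk.
by rewrite adjmxZ ketbra_herm fmorphV rmorph_nat.
Qed.

Lemma key_deviation_tr : \tr key_deviation = 0.
Proof.
have trket (y : Y) : \tr (ketbra R y) = 1.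
  rewrite /mxtrace (bigD1 (enum_rank y)) //= !mxE eqxx big1 ?addr0 // => i.
  by rewrite !mxE => /negPf ->.
have trsum (S : finType) n (w : S -> 'M[C]_n) : \tr (\sum_x w x) = \sum_x \tr (w x).
  exact: raddf_sum.
have tr_cq : \tr (cq_mx (single_key rho e)) = \sum_x \tr (single_key rho e x).
  by rewrite trsum; apply: eq_bigr => y _; rewrite tens_trace trket mul1r.
have tr_u : \tr (uniform_mx R Y) = 1.
  rewrite trsum (eq_bigr (fun=> (#|Y|%:R)^-1)) => [|y _]; last first.
    by rewrite mxtraceZ trket mulr1.
  rewrite sumr_const -[_ *+ _]mulr_natl mulfV //.
  by rewrite pnatr_eq0 -lt0n; apply/card_gt0P; exists 0.
by rewrite /key_deviation linearB /= tens_trace tr_cq tr_u mul1r trsum subrr.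
Qed.

(** The gap between the two sums is the value of the combined test on [key_deviation], a traceless
    Hermitian operator. *)
Lemma private_step (f : K -> 'M[C]_d -> R) : (forall q, effect (f q)) ->
  private (single_key rho e) eps ->
  \sum_q f q (rho q) <=
  #|Y|%:R^-1 * (\sum_z \sum_q f q (rho (q + single e z))) + eps.
Proof.
move=> ef priv; rewrite -lerBlDl; apply: le_trans priv.
rewrite -/key_deviation.
have := effect_le_trace_norm (block_effect ef) key_deviation_herm key_deviation_tr.
apply: le_trans; rewrite le_eqVlt; apply/orP; left; apply/eqP.
rewrite exchange_big mulr_sumr -sumrB; apply: eq_bigr => q _.
rewrite block_deviation (effectB _ _ (ef q)); case: (ef q) => _ -> _.
by rewrite effect_sum.
Qed.

(** The zero test makes both sums vanish. The sign of [eps] is what allows rounding the number of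
    edges up to [n * l]. *)
Lemma private_ge0 : private (single_key rho e) eps -> 0 <= eps.
Proof.
have e0 : effect (fun=> 0 : R).
  by move=> n; split=> *; rewrite ?addr0 ?mulr0 // lexx psdmx_trace_ge0.
move/(@private_step (fun _ _ => 0)) => /(_ (fun=> @e0 _)).
by rewrite !big1 ?mulr0 ?add0r // => *; rewrite big1.
Qed.

End Block.

(* Hybrid argument: [W (h r p)] averaged over [p] is the value of the tests when
   the keys in [r] have been shifted by independent uniform values. *)
Lemma private_hybrid (f : K -> 'M[C]_d -> R) : (forall q, effect (f q)) ->
  (forall e, private (single_key rho e) eps) ->
  \sum_q f q (rho q) <=
  #|K|%:R^-1 * (\sum_q f q (\sum_p rho p)) + #|I|%:R * eps.
Proof.
move=> ef priv; pose W (p : K) := \sum_q f q (rho (q + p)).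
have W_step e p : W p <= #|Y|%:R^-1 * (\sum_z W (p + single e z)) + eps.
  (* Reindexing moves the shift [p] from the state to the tests, so that the one-key step applies to
     [rho] itself. *)
  have WE (p' : K) : W (p + p') = \sum_(q : K) f (q - p) (rho (q + p')).
    rewrite /W (reindex_inj (addIr (- p))) /=.
    by apply: eq_bigr => q _; rewrite addrA subrK.
  have := private_step (fun q : K => ef (q - p)) (priv e).
  rewrite -[in W p](addr0 p) WE; congr (_ <= _).
    by apply: eq_bigr => q _; rewrite addr0.
  by congr (_ * _ + _); apply: eq_bigr => z _; rewrite WE.
pose h (r : seq I) (p : K) : K := [ffun i => if i \in r then p i else 0].
have K0 : #|K|%:R != 0 :> R.
  by rewrite pnatr_eq0 -lt0n; apply/card_gt0P; exists 0.
have Y0 : #|Y|%:R != 0 :> R.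
  by rewrite pnatr_eq0 -lt0n; apply/card_gt0P; exists 0.
have hyb (r : seq I) : uniq r ->
    W 0 <= #|K|%:R^-1 * (\sum_p W (h r p)) + (size r)%:R * eps.
  elim: r => [_ | e r IHr /= /andP[er ur]].
    rewrite (eq_bigr (fun=> W 0)) => [|p _]; last first.
      by congr W; apply/ffunP => i; rewrite !ffunE.
    by rewrite sumr_const -[W 0 *+ _]mulr_natl mulKf // mul0r addr0.
  apply: le_trans (IHr ur) _; rewrite -natr1 mulrDl mul1r [_ + eps]addrC addrA.
  rewrite lerD2r mulrC -ler_pdivlMr ?invr_gt0 ?lt0r ?K0 ?ler0n //.
  rewrite invrK mulrDl mulrAC mulVf // mul1r.
  have -> : eps * #|K|%:R = \sum_(p : K) eps by rewrite sumr_const mulr_natr.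
  apply: (le_trans (ler_sum _ (fun p _ => W_step e (h r p)))).
  rewrite big_split /= lerD2r -mulr_sumr.
  (* As [e] is not in [r], a uniform shift at [e] can be absorbed into the average over [p]. *)
  have hE p z : h r p + single e (p e + z) = h (e :: r) (p + single e z).
    apply/ffunP => i; rewrite !ffunE inE; case: eqVneq => [-> | _] /=.
      by rewrite (negPf er) add0r.
    by rewrite !addr0.
  rewrite mulrC ler_pdivrMr ?lt0r ?Y0 ?ler0n //.
  rewrite (eq_bigr (fun p => \sum_z W (h (e :: r) (p + single e z)))); last first.
    move=> p _; rewrite (reindex_inj (addrI (p e))) /=.
    by apply: eq_bigr => z _; rewrite hE.
  rewrite exchange_big /= (eq_bigr (fun=> \sum_p W (h (e :: r) p))); last first.
    by move=> z _; rewrite [RHS](reindex_inj (addIr (single e z))).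
  by rewrite sumr_const mulr_natr.
have := hyb (enum I) (enum_uniq I); rewrite -cardE.
have -> : W 0 = \sum_q f q (rho q) by apply: eq_bigr => q _; rewrite addr0.
move/le_trans; apply; rewrite lerD2r le_eqVlt; apply/orP; left; apply/eqP.
congr (_ * _).
(* Once every key is shifted, the sum over [p] of [rho (q + p)] is the same for all [q]: the state
   has become independent of the keys. *)
rewrite (eq_bigr W) => [|p _]; last first.
  by congr W; apply/ffunP => i; rewrite ffunE mem_enum.
rewrite exchange_big; apply: eq_bigr => q _.
by rewrite effect_sum // [RHS](reindex_inj (addrI q)).
Qed.

End Hybrid.

(** * Averaging over coins and over shares *)

Section Distributions.
Variable R : rcfType.

Lemma effect_mix (T : finType) (p : dist R T) n (f : T -> 'M[R[i]]_n -> R) :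
  (forall t, effect (f t)) -> effect (fun A => \sum_t p t * f t A).
Proof.
move=> ef; split=> [A B | a A | A psdA].
- rewrite -big_split /=; apply: eq_bigr => t _.
  by case: (ef t) => -> _ _; rewrite mulrDr.
- rewrite mulr_sumr; apply: eq_bigr => t _.
  by case: (ef t) => _ -> _; rewrite mulrCA.
have fb t : 0 <= f t A <= complex.Re (\tr A) by case: (ef t) => _ _; apply.
rewrite sumr_ge0 => [/= | t _]; last first.
  by rewrite mulr_ge0 ?pmf_ge0 //; case/andP: (fb t).
rewrite -[leRHS]mul1r -(pmf_sum1 p) mulr_suml; apply: ler_sum => t _.
by rewrite ler_wpM2l ?pmf_ge0 //; case/andP: (fb t).
Qed.

(** [F] factors through the masked shares, whose distribution is the same for every secret. *)
Lemma confidential_sum n (Y G : finZmodType) (Q : {set {set 'I_n}})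
    (Share : G -> dist R {ffun 'I_n -> Y}) (A : {set 'I_n})
    (F : {ffun 'I_n -> Y} -> R) (g g' : G) :
  perfectly_confidential Q Share -> A \notin Q ->
  (forall x x', Defs.mask A x = Defs.mask A x' -> F x = F x') ->
  \sum_x Share g x * F x = \sum_x Share g' x * F x.
Proof.
move=> conf AQ F_mask.
pose F' y := if [pick x | Defs.mask A x == y] is Some x then F x else 0.
suff E h : \sum_x Share h x * F x =
    \sum_y Pr (Share h) [pred x | Defs.mask A x == y] * F' y.
  by rewrite !E; apply: eq_bigr => y _; rewrite (conf A AQ g g').
rewrite (partition_big (Defs.mask A) predT) //=; apply: eq_bigr => y _.
rewrite /Pr mulr_suml; apply: eq_bigr => x /= /eqP xy; congr (_ * _).
rewrite /F'; case: pickP => [x' /eqP x'y | /(_ x)]; last by rewrite xy eqxx.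
by apply: F_mask; rewrite xy x'y.
Qed.

End Distributions.

(** * Linearity of recovery with missing shares *)

Section Recovery.
Variables (R : rcfType) (n : nat) (Y G : finZmodType) (Q : {set {set 'I_n}}).
Variables (Share : G -> dist R {ffun 'I_n -> Y}).
Variables (Recover : {ffun 'I_n -> option Y} -> option G).

(** If the entries present in [D] form a qualified set, masking [x] to them still recovers [g] and
    linearity applies; otherwise both sides are [None]. *)
Lemma recover_shift g x (D : {ffun 'I_n -> option Y}) :
  secret_sharing Q Share Recover -> linear_recover Recover -> 0 < Share g x ->
  Recover [ffun i => oadd (Some (x i)) (D i)] = oadd (Some g) (Recover D).
Proof.
move=> [correct reject] lin gx; set X := finfun _.
have pX : present X = present D.
  by apply/setP => i; rewrite !inE ffunE; case: (D i).
have [BQ | BQ] := boolP (present D \in Q); last by rewrite !reject ?pX.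
rewrite -(correct g x gx _ BQ) -lin.
  congr Recover; apply/ffunP => i; rewrite !ffunE inE.
  by case: (D i).
by apply/setP => i; rewrite !inE ffunE inE; case: (D i).
Qed.

End Recovery.

(** * Dependence of a run on the state and on the shares *)

Section Runs.
Variables (R : rcfType) (n : nat) (m : 'I_n -> nat) (Y : finZmodType).
Local Notation C := R[i].
Local Notation leaf := ({ffun 'I_n -> option Y} * {set 'I_n})%type.
Implicit Types (q k : keys m Y) (x y : {ffun 'I_n -> Y}) (o : leaf).

(** Completeness of the Kraus operators makes the traces of the branches add up to the trace of the
    state. *)
Lemma run_effect q win d (st : strategy R m Y d) Rs T :
  effect (run q win st Rs T).
Proof.
elim: st Rs T => {d} [d c | d v c next IH | d v next IH | d d' r K K1 next IH] Rs T /=.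
- case: (win c T); split=> [A B | a A | A psdA].
  + exact: RemxtrD.
  + exact: RemxtrZ.
  + by rewrite lexx psdmx_trace_ge0.
  + by rewrite addr0.
  + by rewrite mulr0.
  + by rewrite lexx psdmx_trace_ge0.
- by case: (v \in Rs).
- by case: (v \in Rs).
split=> [A B | a A | A psdA].
- rewrite -big_split /=; apply: eq_bigr => z _; case: (IH z Rs T) => <- _ _.
  by rewrite mulmxDr mulmxDl.
- rewrite mulr_sumr; apply: eq_bigr => z _; case: (IH z Rs T) => _ <- _.
  by rewrite -scalemxAr -scalemxAl.
have rb z := let: And3 _ _ b := IH z Rs T in b _ (psdmx_congr (K z) psdA).
rewrite sumr_ge0 => [/= | z _]; last by case/andP: (rb z).
apply: (@le_trans _ _ (\sum_z complex.Re (\tr (K z *m A *m K z ^t*)))).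
  by apply: ler_sum => z _; case/andP: (rb z).
rewrite -[A in leRHS]mul1mx -K1 mulmx_suml (raddf_sum (@mxtrace _ d)).
rewrite raddf_sum /= le_eqVlt.
apply/orP; left; apply/eqP; apply: eq_bigr => z _.
by rewrite mxtrace_mulC mulmxA.
Qed.

(** Used as a winning condition, it makes [run] the probability of ending exactly in [o]. *)
Definition at_leaf o (c : {ffun 'I_n -> option Y}) (T : {set 'I_n}) : bool :=
  (c, T) == o.

Lemma run_leaves q win d (st : strategy R m Y d) Rs T rho :
  run q win st Rs T rho =
  \sum_o (win o.1 o.2)%:R * run q (at_leaf o) st Rs T rho.
Proof.
elim: st Rs T rho => {d} [d c | d v c next IH | d v next IH | d d' r K K1 next IH]
  Rs T rho /=.
- rewrite (bigD1 (c, T)) //= /at_leaf eqxx big1 => [|o /negPf oN].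
    by case: (win c T); rewrite ?mul1r ?mul0r addr0.
  by rewrite eq_sym oN mulr0.
- by case: (v \in Rs).
- by case: (v \in Rs).
under eq_bigr do rewrite IH.
by rewrite exchange_big; apply: eq_bigr => o _; rewrite mulr_sumr.
Qed.

(** The corrupted set only grows during a run. *)
Lemma run_leaf_corrupted q o d (st : strategy R m Y d) Rs (T : {set 'I_n}) rho :
  ~~ (T \subset o.2) -> run q (at_leaf o) st Rs T rho = 0.
Proof.
elim: st Rs T rho => {d} [d c | d v c next IH | d v next IH | d d' r K K1 next IH]
  Rs T rho /= To.
- by rewrite /at_leaf; case: eqP To => [<- | //]; rewrite subxx.
- by case: (v \in Rs); rewrite IH.
- case: (v \in Rs); first by rewrite IH.
  by rewrite IH // subUset negb_and To orbT.
- by apply: big1 => z _; rewrite IH.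
Qed.

(* Key material in the coordinates of the ideal game: [k] is the key plus the
   share carried by the path.  In these coordinates the view of the adversary
   depends on the shares only through the answers of [Corrupt]. *)
Definition unmask k x : keys m Y := [ffun e : edge m => k e - x (tag e)].

Lemma unmask_inj x : injective (unmask^~ x).
Proof.
move=> k k' /ffunP eq_k; apply/ffunP => e; have := eq_k e.
by rewrite !ffunE; apply: addIr.
Qed.

(** In an answer of [Relay] the share cancels. An answer of [Corrupt] shows the share of its path;
    if that path is outside [o.2], the ending [o] is out of reach and both sides are 0. *)
Lemma run_leaf_local k x y o d (st : strategy R m Y d) Rs T rho :
  {in o.2, x =1 y} ->
  run (unmask k x) (at_leaf o) st Rs T rho =
  run (unmask k y) (at_leaf o) st Rs T rho.
Proof.
move=> xy.
have shiftK (c a b z : Y) : c - (a - z) + (b - z) = c - a + b.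
  by rewrite opprB [z - _]addrC [_ - z]addrC !addrA addrK.
elim: st Rs T rho => {d} [d c | d v c next IH | d v next IH | d d' r K K1 next IH]
  Rs T rho //=.
- case: (v \in Rs); rewrite IH //; congr (run _ _ (next _) _ _ _).
  by case: c => //= c; rewrite !ffunE /= !shiftK.
- case: (v \in Rs); first by rewrite IH.
  have [vo | vo] := boolP (tag v \in o.2).
    by rewrite IH !ffunE /= xy.
  by rewrite !run_leaf_corrupted // subUset sub1set (negPf vo).
- by apply: eq_bigr => z _; rewrite IH.
Qed.

End Runs.

(** * The game with uniform independent keys *)

Section Ideal.
Variables (R : rcfType) (n : nat) (m : 'I_n -> nat) (Y G : finZmodType).
Variables (Q : {set {set 'I_n}}) (Share : G -> dist R {ffun 'I_n -> Y}).
Variables (Recover : {ffun 'I_n -> option Y} -> option G).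
Hypothesis SS : secret_sharing Q Share Recover.
Hypothesis SS_conf : perfectly_confidential Q Share.
Hypothesis SS_linear : linear_recover Recover.
Variables (S : eqType) (Encode : S -> dist R G) (Decode : G -> option S).
Variables (delta : R).
Hypothesis AMD : amd_code Encode Decode delta.
Local Notation RecoverS := (fun x => obind Decode (Recover x)).
Implicit Types (k : keys m Y) (s : S) (g : G) (c : {ffun 'I_n -> option Y}).

Lemma amd_delta_ge0 s : 0 <= delta.
Proof.
apply: le_trans (AMD.2 s 0).
by apply: sumr_ge0 => g _; apply: pmf_ge0.
Qed.

(** The shift of the codeword caused by tampering: S'_i - S_i is c_i minus [k] at the last edge,
    free of the shares. *)
Definition offset k c : option G :=
  Recover [ffun i => osub (c i) (Some (k (last_edge m i)))].

Definition tampered k s g c : bool :=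
  if offset k c is Some D then Decode (g + D) \notin [:: Some s; None]
  else false.

Lemma forged_unmask k s g x c (T : {set 'I_n}) : 0 < Share g x ->
  forged Q RecoverS (unmask k x) s c T = tampered k s g c && (T \notin Q).
Proof.
move=> gx; rewrite /forged /tampered /offset; congr (_ && _).
have -> : [ffun i => osub (c i) (Some (unmask k x (last_edge m i)))] =
    [ffun i => oadd (Some (x i)) ([ffun i => osub (c i) (Some (k (last_edge m i)))] i)].
  apply/ffunP => i; rewrite !ffunE; case: (c i) => //= y.
  by rewrite opprB addrCA.
rewrite (recover_shift _ SS SS_linear gx).
by case: (Recover _) => //=; rewrite !inE eqxx orbT.
Qed.

(** For fixed [k] and [c] the offset does not depend on the codeword, as the AMD property
    requires. *)
Lemma tampered_prob k s c :
  \sum_g Encode s g * (tampered k s g c)%:R <= delta.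
Proof.
rewrite /tampered; case: offset => [D|]; last first.
  by rewrite big1 ?amd_delta_ge0 // => g _; rewrite mulr0.
apply: le_trans (AMD.2 s D); rewrite /Pr [leRHS]big_mkcond /=.
by apply: ler_sum => g _; case: (_ \notin _); rewrite ?mulr1 ?mulr0.
Qed.

Lemma ideal_forge_key k s d (st : strategy R m Y d) (sigma : 'M[R[i]]_d) :
  psdmx sigma ->
  \sum_g Encode s g * (\sum_x Share g x *
     run (unmask k x) (forged Q RecoverS (unmask k x) s) st set0 set0 sigma)
  <= delta * complex.Re (\tr sigma).
Proof.
move=> psd_sigma.
pose mu x o := run (unmask k x) (at_leaf o) st set0 set0 sigma.
have runE x win : run (unmask k x) win st set0 set0 sigma =
    \sum_o (win o.1 o.2)%:R * mu x o by apply: run_leaves.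
have run_bd x win :
    0 <= run (unmask k x) win st set0 set0 sigma <= complex.Re (\tr sigma).
  by case: (run_effect (unmask k x) win st set0 set0) => _ _; apply.
(* The secret 0 is an arbitrary reference; confidentiality allows any other when the corrupted set
   is unqualified. *)
pose nu o := \sum_x Share 0 x * mu x o.
have nu_ge0 o : 0 <= nu o.
  apply: sumr_ge0 => x _; rewrite mulr_ge0 ?pmf_ge0 //.
  by case/andP: (run_bd x (at_leaf o)).
have muE g o : o.2 \notin Q -> \sum_x Share g x * mu x o = nu o.
  move=> oQ; apply: (confidential_sum _ _ SS_conf oQ) => x y /ffunP eq_xy.
  apply: run_leaf_local => i io; have := eq_xy i.
  by rewrite !ffunE io => -[].
have -> : \sum_g Encode s g * (\sum_x Share g x *
     run (unmask k x) (forged Q RecoverS (unmask k x) s) st set0 set0 sigma) =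
    \sum_(o | o.2 \notin Q)
      nu o * \sum_g Encode s g * (tampered k s g o.1)%:R.
  rewrite [RHS](eq_bigr _ (fun o _ => mulr_sumr _ _ _ _)) exchange_big /=.
  apply: eq_bigr => g _.
  under [RHS]eq_bigr => o oQ do rewrite -(muE g o oQ) mulr_suml.
  rewrite exchange_big /= mulr_sumr; apply: eq_bigr => x _.
  (* Recovery is known only for share vectors of positive probability; the others contribute 0. *)
  have := pmf_ge0 (Share g) x; rewrite le_eqVlt => /orP[/eqP <- | gx].
    by rewrite mul0r mulr0 big1 // => o _; rewrite !mul0r.
  rewrite runE !mulr_sumr [RHS]big_mkcond; apply: eq_bigr => o _.
  rewrite (forged_unmask _ _ _ _ gx).
  case: (o.2 \notin Q); last by rewrite andbF mul0r !mulr0.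
  by rewrite andbT; ring.
apply: (@le_trans _ _ (\sum_(o | o.2 \notin Q) delta * nu o)).
  apply: ler_sum => o _; rewrite [delta * _]mulrC.
  by rewrite ler_wpM2l ?tampered_prob.
rewrite -mulr_sumr ler_wpM2l ?(amd_delta_ge0 s) //.
have -> : \sum_(o | o.2 \notin Q) nu o = \sum_x Share 0 x *
    run (unmask k x) (fun _ T => T \notin Q) st set0 set0 sigma.
  rewrite exchange_big /=; apply: eq_bigr => x _; rewrite runE mulr_sumr.
  rewrite big_mkcond; apply: eq_bigr => o _.
  by case: (o.2 \notin Q); rewrite ?mul1r ?mul0r ?mulr0.
rewrite -[leRHS]mul1r -(pmf_sum1 (Share 0)) mulr_suml; apply: ler_sum => x _.
by rewrite ler_wpM2l ?pmf_ge0 //; case/andP: (run_bd x (fun _ T => T \notin Q)).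
Qed.

Lemma ideal_forge s d (st : {ffun 'I_n -> Y} -> strategy R m Y d)
    (sigma : 'M[R[i]]_d) : psdmx sigma ->
  \sum_x dbind (Encode s) Share x * (\sum_(q : keys m Y)
    run q (forged Q RecoverS q s) (st [ffun i => x i + q (first_edge m i)])
      set0 set0 sigma)
  <= #|{: keys m Y}|%:R * (delta * complex.Re (\tr sigma)).
Proof.
move=> psd_sigma.
pose F k g x := Encode s g * (Share g x *
  run (unmask k x) (forged Q RecoverS (unmask k x) s)
    (st [ffun i => k (first_edge m i)]) set0 set0 sigma).
rewrite (eq_bigr (fun x => \sum_g \sum_k F k g x)) => [|x _]; last first.
  (* Substituting q = k - x turns the first ciphertexts x + q into [k], so the strategy no longer
     depends on the shares. *)
  rewrite (reindex_inj (@unmask_inj _ m _ x)) /= /dbind_pmf mulr_suml.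
  apply: eq_bigr => g _; rewrite mulr_sumr; apply: eq_bigr => k _.
  rewrite /F mulrA; congr (_ * run _ _ (st _) _ _ _).
  by apply/ffunP => i; rewrite !ffunE addrC subrK.
have -> : \sum_x \sum_g \sum_k F k g x = \sum_k \sum_g \sum_x F k g x.
  rewrite exchange_big [RHS]exchange_big /=; apply: eq_bigr => g _.
  by rewrite exchange_big.
rewrite -sum1_card natr_sum mulr_suml; apply: ler_sum => k _; rewrite mul1r.
rewrite /F; under eq_bigr do rewrite -mulr_sumr.
exact: ideal_forge_key.
Qed.

End Ideal.

(** * Combining key replacement with the bound for the ideal game *)

Theorem theorem4
  (R : rcfType)
  (* the network, and n disjoint paths of length at most l *)
  (V : finType) (adj : rel V) (adj_sym : symmetric adj) (alice bob : V)
  (n l : nat) (P : 'I_n -> seq V)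
  (P_path : forall i, network_path adj alice bob (P i))
  (P_disjoint : pairwise_disjoint P)
  (P_length : forall i, (path_length (P i) <= l)%N)
  (* the secret-sharing scheme *)
  (Y G : finZmodType) (Q : {set {set 'I_n}}) (Q_nonempty : Q != set0)
  (Share : G -> dist R {ffun 'I_n -> Y})
  (Recover : {ffun 'I_n -> option Y} -> option G)
  (SS : secret_sharing Q Share Recover)
  (SS_confidential : perfectly_confidential Q Share)
  (SS_linear : linear_recover Recover)
  (* the AMD code *)
  (S : eqType) (Encode : S -> dist R G) (Decode : G -> option S) (delta : R)
  (AMD : amd_code Encode Decode delta)
  (* the keys and the quantum side information *)
  (d : nat) (rho : cqstate R (keys (fun i => size (P i)) Y) d) (eps : R)
  (keys_private : forall e : edge (fun i => size (P i)),
     private (single_key rho e) eps)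
  (A : adversary R (fun i => size (P i)) Y S d) :
  forge_relay Q (fun s => dbind (Encode s) Share)
    (fun x => obind Decode (Recover x)) rho A
  <= n%:R * l%:R * eps + delta.
Proof.
set m := fun i => size (P i).
have rho_psd q : psdmx (rho q) := cq_psd rho q.
have edges : (#|{: edge m}| <= n * l)%N.
  rewrite card_tagged sumnE big_map big_enum /= -[in leqRHS](card_ord n).
  rewrite -sum_nat_const; apply: leq_sum => i _; rewrite card_ord.
  exact: P_length.
have edge_eps : #|{: edge m}|%:R * eps <= n%:R * l%:R * eps.
  (* For n = 0 there is no edge from which to obtain 0 <= [eps], but also no key to replace. *)
  case: (posnP n) => [n0 | n_gt0].
    have n0R : n%:R = 0 :> R by rewrite n0.
    have /eqP -> : #|{: edge m}| == 0%N.
      by rewrite -leqn0 (leq_trans edges) // n0.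
    by rewrite n0R !mul0r.
  have e := first_edge m (Ordinal n_gt0).
  rewrite -natrM ler_wpM2r ?ler_nat //.
  exact: (private_ge0 rho_psd (keys_private e)).
pose ShareS s := dbind (Encode s) Share.
pose win (q : keys m Y) s := forged Q (fun x => obind Decode (Recover x)) q s.
pose st w (x : {ffun _ -> Y}) (q : keys m Y) :=
  adv_relay (a := A) w [ffun i => x i + q (first_edge m i)].
(* The whole game, for fixed keys, as one test on the quantum state. *)
pose F (q : keys m Y) X := \sum_w coins_dist A w *
  (\sum_x ShareS (adv_secret w) x *
    run q (win q (adv_secret w)) (st w x q) set0 set0 X).
have F_effect q : effect (F q).
  by apply: effect_mix => w; apply: effect_mix => x; apply: run_effect.
have gameE X : \sum_w coins_dist A w *
    (\sum_x ShareS (adv_secret w) x *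
      \sum_q run q (win q (adv_secret w)) (st w x q) set0 set0 (X q)) =
    \sum_q F q (X q).
  rewrite [RHS]exchange_big /=; apply: eq_bigr => w _; rewrite -mulr_sumr.
  congr (_ * _); rewrite [RHS]exchange_big /=; apply: eq_bigr => x _.
  by rewrite mulr_sumr.
rewrite /forge_relay gameE addrC.
apply: le_trans (private_hybrid rho_psd F_effect keys_private) _.
rewrite lerD ?edge_eps //.
set sigma := \sum_p rho p.
have tr_sigma : complex.Re (\tr sigma) = 1.
  by rewrite (raddf_sum (@mxtrace _ d)) /= (cq_trace1 rho).
have K_gt0 : 0 < #|{: keys m Y}|%:R :> R.
  by rewrite ltr0n; apply/card_gt0P; exists [ffun=> 0].
(* Clearing the normalisation of the uniform keys leaves the bound with the factor [#|keys|] proved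
   for the ideal game. *)
rewrite ler_pdivrMl // -(gameE (fun=> sigma)).
rewrite -[leRHS]mul1r -[X in _ <= X * _](pmf_sum1 (coins_dist A)) mulr_suml.
apply: ler_sum => w _; rewrite ler_wpM2l ?pmf_ge0 //.
have sigma_psd : psdmx sigma by apply: psdmx_sum.
have := ideal_forge SS SS_confidential SS_linear AMD (adv_secret w)
          (adv_relay (a := A) w) sigma_psd.
by rewrite tr_sigma mulr1.
Qed.
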